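(* Work over the semifield $\mathbb{R}_{\max,+}$. Let $\bm{C}$ be an irreducible $n\times n$ matrix with $\mathop{\mathrm{Tr}}(\bm{C})\leq\mathbb{1}$, and let $\bm{C}^{\ast}=(c_{ij}^{\ast})$ be its asterate, with columns $\bm{c}_1^{\ast},\ldots,\bm{c}_n^{\ast}$. Define the scalar $$\Delta=\|\bm{C}^{\ast}(\bm{C}^{\ast})^{-}\|.$$ Consider the problem of maximizing $\|\bm{x}\|\,\|\bm{x}^{-}\|$ over all regular vectors $\bm{x}$ with $n$ components subject to $\bm{C}\bm{x}\leq\bm{x}$. Then the maximum is equal to $\Delta$, and a regular vector $\bm{x}$ is feasible and attains it if and only if $\bm{x}=\bm{C}^{\ast}\bm{u}$ for some regular vector $\bm{u}=(u_i)$ for which there exist a scalar $\alpha>\mathbb{0}$, an index $k\in\{1,\ldots,n\}$ at which $\|\bm{c}_{i}^{\ast}\|\,\|(\bm{c}_{i}^{\ast})^{-}\|$ is maximal over $1\leq i\leq n$, and an index $s\in\{1,\ldots,n\}$ at which $(c_{ik}^{\ast})^{-1}$ is maximal over $1\leq i\leq n$, such that $$u_{k}=\alpha\,\|(\bm{c}_{k}^{\ast})^{-}\|,\qquad u_{j}\leq\alpha\,(c_{sj}^{\ast})^{-1}\quad\text{for all } j\ne k.$$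
   Context: $\mathbb{R}_{\max,+}=\langle\mathbb{R}\cup\{-\infty\},-\infty,0,\max,+\rangle$ is the semifield whose addition $\oplus$ is $\max$, with zero $\mathbb{0}=-\infty$, and whose multiplication $\otimes$ (sign omitted) is ordinary addition, with unit $\mathbb{1}=0$; the multiplicative inverse $x^{-1}$ of $x\in\mathbb{R}$ is $-x$, and the order is the usual one (entrywise for vectors). All scalar, matrix and vector operations in the claim are understood in this semifield. $\bm{I}$ is the identity matrix ($\mathbb{1}$ on the diagonal, $\mathbb{0}$ elsewhere), and $\bm{C}^0=\bm{I}$. A square matrix is reducible if it can be put in a block-triangular form with zero blocks above (or below) the diagonal by a simultaneous permutation of rows and columns; otherwise it is irreducible. For an $n\times n$ matrix $\bm{C}=(c_{ij})$, $\mathop{\mathrm{tr}}\bm{C}=\bigoplus_{i=1}^{n}c_{ii}$ and $\mathop{\mathrm{Tr}}(\bm{C})=\mathop{\mathrm{tr}}\bm{C}\oplus\cdots\oplus\mathop{\mathrm{tr}}\bm{C}^{n}$. When $\mathop{\mathrm{Tr}}(\bm{C})\leq\mathbb{1}$, the asterate of $\bm{C}$ is $\bm{C}^{\ast}=\bm{I}\oplus\bm{C}\oplus\cdots\oplus\bm{C}^{n-1}$; for irreducible $\bm{C}$ it has no entries equal to $\mathbb{0}$. A vector is regular if none of its components is $\mathbb{0}$. For a regular column vector $\bm{x}=(x_i)$, $\bm{x}^{-}$ is the row vector with components $x_i^{-1}$. For a matrix $\bm{A}=(a_{ij})$ without entries equal to $\mathbb{0}$, $\bm{A}^{-}$ is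 the matrix whose $(i,j)$ entry is $a_{ji}^{-1}$. For a (row or column) vector or a matrix, $\|\cdot\|$ denotes the $\oplus$-sum (i.e. the maximum) of all its entries. *)

(* Defs.v *)
From HB Require Import structures.
From mathcomp Require Import all_boot all_order all_fingroup all_algebra.
From mathcomp Require Import reals.

Set Implicit Arguments.
Unset Strict Implicit.
Unset Printing Implicit Defensive.

Import Order.TTheory GRing.Theory Num.Theory.

Local Open Scope ring_scope.

(* The semifield of reals extended by -oo, which is represented by None. With
   the instances below, the generic notations are max-plus ones on this type:
   x + y is the maximum, x * y the ordinary sum, 0 is -oo and 1 is the real 0;
   sums, products, powers and traces of matrices follow suit. *)
Definition maxplus (R : realType) : Type := option R.

Section MaxPlus.
Variable R : realType.
Local Notation T := (maxplus R).

HB.instance Definition _ := Choice.copy T (option R).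

Definition maxplus_le (x y : T) : bool :=
  match x, y with
  | None, _ => true
  | Some _, None => false
  | Some a, Some b => a <= b
  end.

Definition maxplus_add (x y : T) : T :=
  match x, y with
  | None, _ => y
  | _, None => x
  | Some a, Some b => Some (Num.max a b)
  end.

Definition maxplus_mul (x y : T) : T :=
  match x, y with
  | Some a, Some b => Some (a + b)
  | _, _ => None
  end.

(* The inverse of -oo is set to -oo by convention. *)
Definition maxplus_inv (x : T) : T :=
  if x is Some a then Some (- a) else None.

Fact maxplus_le_refl : reflexive maxplus_le.
Proof. by case=> //= a. Qed.

Fact maxplus_le_anti : antisymmetric maxplus_le.
Proof. by case=> [a|] [b|] //= /le_anti->. Qed.

Fact maxplus_le_trans : transitive maxplus_le.
Proof. by case=> [b|] [a|] [c|] //=; apply: le_trans. Qed.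

HB.instance Definition _ := Order.Le_isPOrder.Build ring_display T
  maxplus_le_refl maxplus_le_anti maxplus_le_trans.

Fact maxplus_le_total : total (<=%R : rel T).
Proof. by case=> [a|] [b|] //; apply: le_total. Qed.

HB.instance Definition _ :=
  Order.POrder_isTotal.Build ring_display T maxplus_le_total.

Fact maxplus_addA : associative maxplus_add.
Proof. by case=> [a|] [b|] [c|] //=; rewrite maxA. Qed.

Fact maxplus_addC : commutative maxplus_add.
Proof. by case=> [a|] [b|] //=; rewrite maxC. Qed.

Fact maxplus_add0 : left_id None maxplus_add.
Proof. by case. Qed.

HB.instance Definition _ := GRing.isNmodule.Build T
  maxplus_addA maxplus_addC maxplus_add0.

Fact maxplus_mulA : associative maxplus_mul.
Proof. by case=> [a|] [b|] [c|] //=; rewrite addrA. Qed.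

Fact maxplus_mulC : commutative maxplus_mul.
Proof. by case=> [a|] [b|] //=; rewrite addrC. Qed.

Fact maxplus_mul1 : left_id (Some 0) maxplus_mul.
Proof. by case=> [a|] //=; rewrite add0r. Qed.

Fact maxplus_mulDl : left_distributive maxplus_mul maxplus_add.
Proof. by case=> [a|] [b|] [c|] //=; rewrite addr_maxl. Qed.

Fact maxplus_mul0 : left_zero None maxplus_mul.
Proof. by []. Qed.

Fact maxplus_one_neq0 : Some 0 != None :> T.
Proof. by []. Qed.

HB.instance Definition _ := GRing.Nmodule_isComNzSemiRing.Build T
  maxplus_mulA maxplus_mulC maxplus_mul1 maxplus_mulDl maxplus_mul0
  maxplus_one_neq0.

End MaxPlus.

Definition mxle (R : realType) m n (A B : 'M[maxplus R]_(m, n)) : Prop :=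
  forall i j, A i j <= B i j.

Definition mxregular (R : realType) m n (A : 'M[maxplus R]_(m, n)) : Prop :=
  forall i j, A i j != 0.

(* Multiplicative conjugate transpose; meaningful when A has no entry -oo. *)
Definition mxconj (R : realType) m n (A : 'M[maxplus R]_(m, n)) :
  'M[maxplus R]_(n, m) := (map_mx (@maxplus_inv R) A)^T.

Definition mxnorm (R : realType) m n (A : 'M[maxplus R]_(m, n)) : maxplus R :=
  \sum_i \sum_j A i j.

(* Two nonempty diagonal blocks, of sizes p and n - p, suffice: a finer block
   decomposition can be coarsened to two blocks. *)
Definition reducible (R : realType) n (C : 'M[maxplus R]_n) : Prop :=
  exists (s : 'S_n) (p : nat), let B := row_perm s (col_perm s C) in
    (0 < p < n)%N /\
    ((forall i j : 'I_n, (i < p <= j)%N -> B i j = 0) \/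
     (forall i j : 'I_n, (j < p <= i)%N -> B i j = 0)).

Definition irreducible (R : realType) n (C : 'M[maxplus R]_n) : Prop :=
  ~ reducible C.

Definition Tr (R : realType) n (C : 'M[maxplus R]_n) : maxplus R :=
  \sum_(1 <= k < n.+1) \tr (C ^+ k).

Definition asterate (R : realType) n (C : 'M[maxplus R]_n) : 'M[maxplus R]_n :=
  \sum_(k < n) C ^+ k.

(* Main.v *)
Require Import Defs.
From mathcomp Require Import all_boot all_order all_fingroup all_algebra.
From mathcomp Require Import reals lra.

Set Implicit Arguments.
Unset Strict Implicit.
Unset Printing Implicit Defensive.

Import Order.TTheory GRing.Theory Num.Theory.

Local Open Scope ring_scope.

(* Since Tr C <= 1, every cycle has weight at most 1; deleting a cycle from a
   walk of length n gives C^n <= C*, so that C C* <= C* and the regular feasible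
   vectors are exactly the vectors x = C* u with u regular. Writing the maximal
   entry of x as x_i = c*_ik u_k and its minimal entry as x_s >= c*_sk u_k,
   one gets x_i / x_s <= c*_ik / c*_sk <= Delta. Equality throughout means that
   column k has the largest spread and that s is the place of its minimal entry,
   where x_s = c*_sk u_k; this is the asserted condition with alpha = x_s. *)

(** * Order and finite sums in the max-plus semifield *)

Section MaxPlusOrder.
Variable R : realType.
Implicit Types x y z t : maxplus R.

Lemma mp_ge0 x : 0 <= x :> maxplus R.
Proof. by []. Qed.

Lemma mp_gt0 x : (0 < x :> maxplus R) = (x != 0).
Proof. by rewrite lt_def mp_ge0 andbT. Qed.

Lemma mp_addE_le x y z : (x + y <= z) = (x <= z) && (y <= z).
Proof.
case: x y z => [a|] [b|] [c|] //=; last by rewrite andbT.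
exact: ge_max.
Qed.

Lemma mp_add_or x y : x + y = x \/ x + y = y.
Proof.
case: x y => [a|] [b|]; [|by left|by right|by left].
have : Some (Num.max a b) = Some a \/ Some (Num.max a b) = Some b.
  by case: (leP a b); [right|left].
by [].
Qed.

Lemma mp_le_mul x y z t : x <= y -> z <= t -> x * z <= y * t.
Proof.
by case: x y z t => [a|] [b|] [c|] [d|] //; apply: lerD.
Qed.

Lemma mp_mul_neq0 x y : x != 0 -> y != 0 -> x * y != 0.
Proof. by case: x y => [a|] [b|]. Qed.

(** The factor [z] cancels after [t] is replaced by its lower bound [y * z]. *)
Lemma mp_mul_div_le x y z t :
  y != 0 -> z != 0 -> y * z <= t -> x * z * maxplus_inv t <= x * maxplus_inv y.
Proof.
case: x y z t => [a|] [b|] [c|] [d|] // _ _.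
by rewrite /Order.le /= => ?; lra.
Qed.

Lemma mp_sum_le (I : Type) (r : seq I) (P : pred I) (F : I -> maxplus R) z :
  (forall i, P i -> F i <= z) -> \sum_(i <- r | P i) F i <= z.
Proof.
by move=> Fz; elim/big_ind: _ => // x y xz yz; rewrite mp_addE_le xz.
Qed.

Lemma mp_le_sum (I : eqType) (r : seq I) (F : I -> maxplus R) i :
  i \in r -> F i <= \sum_(j <- r) F j.
Proof.
move=> ir; rewrite (big_rem i ir) /=.
by have := lexx (F i + \sum_(j <- rem i r) F j); rewrite {1}mp_addE_le => /andP[].
Qed.

(** A binary sum is one of its two terms; a zero sum has only zero terms, so any index then
    serves. *)
Lemma mp_sum_eq (I : finType) (F : I -> maxplus R) :
  (0 < #|I|)%N -> exists i, \sum_j F j = F i.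
Proof.
case/card_gt0P => i0 _.
have [//|[i ->]] : \sum_j F j = 0 \/ exists i, \sum_j F j = F i.
- elim/big_ind: _ => [|x y [->|[i ->]] [->|[j ->]]|i _].
  + by left.
  + by left; rewrite addr0.
  + by right; exists j; rewrite add0r.
  + by right; exists i; rewrite addr0.
  + by right; have [->|->] := mp_add_or (F i) (F j); [exists i|exists j].
  + by right; exists i.
- move=> F0; exists i0; apply/eqP; rewrite eq_le {1}F0 mp_ge0 /=.
  by apply: mp_le_sum; rewrite mem_index_enum.
by exists i.
Qed.

End MaxPlusOrder.

(** * Norms, spreads and the extremal problem for a regular matrix *)

Section Norm.
Variable R : realType.

Lemma le_mxnorm m n (A : 'M[maxplus R]_(m, n)) i j : A i j <= mxnorm A.
Proof.
apply: (@le_trans _ _ (\sum_j A i j)); first exact/mp_le_sum/mem_index_enum.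
exact/(mp_le_sum (fun i => \sum_j A i j))/mem_index_enum.
Qed.

Lemma mxnorm_le m n (A : 'M[maxplus R]_(m, n)) z :
  (forall i j, A i j <= z) -> mxnorm A <= z.
Proof. by move=> Az; apply: mp_sum_le => i _; apply: mp_sum_le. Qed.

Lemma mxnorm_eq m n (A : 'M[maxplus R]_(m, n)) :
  (0 < m)%N -> (0 < n)%N -> exists i j, mxnorm A = A i j.
Proof.
rewrite -{1}(card_ord m) -{1}(card_ord n) => m0 n0.
have [i iE] := mp_sum_eq (fun i => \sum_j A i j) m0.
have [j jE] := mp_sum_eq (A i) n0.
by exists i, j; rewrite /mxnorm iE.
Qed.

Lemma mxconjE m n (A : 'M[maxplus R]_(m, n)) i j :
  mxconj A i j = maxplus_inv (A j i).
Proof. by rewrite !mxE. Qed.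

(** For regular [x] with [0 < n], the largest entry minus the smallest in ordinary arithmetic. *)
Definition spread n (x : 'cV[maxplus R]_n) := mxnorm x * mxnorm (mxconj x).

(** Once the sum over [k] is moved outermost, the double sum over entries of column [k] factors. *)
Lemma mxnorm_mul_conj m n (A : 'M[maxplus R]_(m, n)) :
  mxnorm (A *m mxconj A) = \sum_k spread (col k A).
Proof.
rewrite /mxnorm; under eq_bigr => i _.
  under eq_bigr => j _ do rewrite mxE.
  rewrite exchange_big /=; over.
rewrite exchange_big /=; apply: eq_bigr => k _.
rewrite /spread /mxnorm big_ord1 mulr_suml; apply: eq_bigr => i _.
rewrite big_ord1 mxE -mulr_sumr; congr (_ * _).
by apply: eq_bigr => j _; rewrite !mxE.
Qed.

Lemma spread_col_le m n (A : 'M[maxplus R]_(m, n)) k :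
  spread (col k A) <= mxnorm (A *m mxconj A).
Proof.
rewrite mxnorm_mul_conj.
exact/(mp_le_sum (fun k => spread (col k A)))/mem_index_enum.
Qed.

Lemma le_spread n (x : 'cV[maxplus R]_n) i j :
  x i 0 * maxplus_inv (x j 0) <= spread x.
Proof. by rewrite -mxconjE mp_le_mul ?le_mxnorm. Qed.

Lemma spread_eq n (x : 'cV[maxplus R]_n) : (0 < n)%N ->
  exists i j, mxnorm x = x i 0 /\ mxnorm (mxconj x) = maxplus_inv (x j 0).
Proof.
move=> n0; have [i [i' ->]] := mxnorm_eq x n0 isT.
have [j' [j ->]] := mxnorm_eq (mxconj x) isT n0.
by exists i, j; rewrite mxconjE !ord1.
Qed.

Lemma le_spread_col m n (A : 'M[maxplus R]_(m, n)) i j k :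
  A i k * maxplus_inv (A j k) <= spread (col k A).
Proof. by have := le_spread (col k A) i j; rewrite !mxE. Qed.

Lemma le_mulmx_col m n (A : 'M[maxplus R]_(m, n)) (u : 'cV_n) i j :
  A i j * u j 0 <= (A *m u) i 0.
Proof.
by rewrite mxE; apply/(mp_le_sum (fun j => A i j * u j 0))/mem_index_enum.
Qed.

Lemma mulmx_le m1 n m2 (A : 'M[maxplus R]_(m1, n)) (B D : 'M_(n, m2)) :
  mxle B D -> mxle (A *m B) (A *m D).
Proof.
move=> BD i j; rewrite mxE; apply: mp_sum_le => k _; rewrite mxE.
apply: le_trans (mp_le_mul (lexx _) (BD k j)) _.
exact/(mp_le_sum (fun k => A i k * D k j))/mem_index_enum.
Qed.

Lemma mulmx_col_eq m n (A : 'M[maxplus R]_(m, n)) (u : 'cV_n) i :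
  (0 < n)%N -> exists k, (A *m u) i 0 = A i k * u k 0.
Proof.
rewrite -{1}(card_ord n) => n0; rewrite mxE.
exact: (mp_sum_eq (fun j => A i j * u j 0)).
Qed.

Lemma mulmx_regular m n (A : 'M[maxplus R]_(m, n)) (u : 'cV_n) :
  (0 < n)%N -> mxregular A -> mxregular u -> mxregular (A *m u).
Proof.
move=> n0 Ar ur i j; rewrite (ord1 j); have [k ->] := mulmx_col_eq A u i n0.
exact: mp_mul_neq0.
Qed.

Lemma spread_mulmx_le m n (A : 'M[maxplus R]_(m, n)) (u : 'cV_n) :
  (0 < m)%N -> (0 < n)%N -> mxregular A -> mxregular u ->
  spread (A *m u) <= mxnorm (A *m mxconj A).
Proof.
move=> m0 n0 Ar ur; rewrite /spread.
have [i [s [-> ->]]] := spread_eq (A *m u) m0.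
have [k ik] := mulmx_col_eq A u i n0; rewrite ik.
apply: le_trans (spread_col_le A k).
apply: le_trans (le_spread_col A i s k).
exact: mp_mul_div_le (Ar _ _) (ur _ _) (le_mulmx_col _ _ _ _).
Qed.

Lemma spread_mulmx_eq m n (A : 'M[maxplus R]_(m, n)) (u : 'cV_n) :
    (0 < m)%N -> (0 < n)%N -> mxregular A -> mxregular u ->
  spread (A *m u) = mxnorm (A *m mxconj A) <->
  exists (alpha : maxplus R) (k : 'I_n) (s : 'I_m),
    [/\ 0 < alpha :> maxplus R,
        forall i, spread (col i A) <= spread (col k A),
        forall i, maxplus_inv (A i k) <= maxplus_inv (A s k),
        u k 0 = alpha * mxnorm (mxconj (col k A))
      & forall j, j != k -> u j 0 <= alpha * maxplus_inv (A s j)].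
Proof.
move=> m0 n0 Ar ur; have Aur := mulmx_regular n0 Ar ur; split.
- move=> spE; have [i [s [xi xs]]] := spread_eq (A *m u) m0.
  have [k ik] := mulmx_col_eq A u i n0.
  have [t [t' [_ Nt]]] := spread_eq (col k A) m0.
  have DE : A i k * u k 0 * maxplus_inv ((A *m u) s 0) = mxnorm (A *m mxconj A).
    by rewrite -spE /spread xi xs ik.
  have skx := le_mulmx_col A u s k.
  have Dk : mxnorm (A *m mxconj A) <= spread (col k A).
    rewrite -DE; apply: le_trans (le_spread_col A i s k).
    exact: mp_mul_div_le (Ar s k) (ur k 0) skx.
  (* [t'] is the place of the least entry of column [k]. Since [A i k / A t' k] is at most the
     maximum [A i k * u k / x_s], cancelling [A i k] gives [x_s <= A t' k * u k]. *)
  have kt : maxplus_inv (A t' k) * (A *m u) s 0 <= u k 0.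
    have := le_trans (le_spread_col A i t' k) (spread_col_le A k).
    rewrite -DE.
    move: (Ar i k) (Ar t' k) (ur k 0) (Aur s 0).
    case: (A i k) (A t' k) (u k 0) ((A *m u) s 0) => [a|] [b|] [c|] [d|] // _ _ _ _.
    by rewrite /Order.le /= => ?; lra.
  (* With [A s k * u k <= x_s], this yields [A s k <= A t' k]: row [s] is also a place of the least
     entry. *)
  have ksmax : mxnorm (mxconj (col k A)) = maxplus_inv (A s k).
    apply/eqP; rewrite eq_le.
    have := le_mxnorm (mxconj (col k A)) 0 s; rewrite mxconjE mxE => ->.
    rewrite andbT Nt mxE.
    move: (Ar s k) (Ar t' k) (ur k 0) (Aur s 0) kt skx.
    case: (A s k) (A t' k) (u k 0) ((A *m u) s 0) => [a|] [b|] [c|] [d|] // _ _ _ _.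
    by rewrite /Order.le /= => ? ?; lra.
  exists ((A *m u) s 0), k, s; split.
  + by rewrite mp_gt0.
  + by move=> j; apply: le_trans (spread_col_le A j) Dk.
  + move=> j; rewrite -ksmax.
    by have := le_mxnorm (mxconj (col k A)) 0 j; rewrite mxconjE mxE.
  + move: kt; rewrite ksmax; have := Nt; rewrite ksmax mxE => <-.
    move: (Ar s k) (ur k 0) (Aur s 0) skx.
    case: (A s k) (u k 0) ((A *m u) s 0) => [a|] [c|] [d|] // _ _ _.
    by rewrite /Order.le /= => ? ?; congr Some; lra.
  + move=> j _; have := le_mulmx_col A u s j.
    move: (Ar s j) (ur j 0) (Aur s 0).
    case: (A s j) (u j 0) ((A *m u) s 0) => [a|] [c|] [d|] // _ _ _.
    by rewrite /Order.le /= => ?; lra.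
- case=> alpha [k [s [alpha0 kmax smax uk uj]]].
  have NE : mxnorm (mxconj (col k A)) = maxplus_inv (A s k).
    apply/eqP; rewrite eq_le; apply/andP; split.
      by apply: mxnorm_le => i j; rewrite mxconjE mxE.
    by have := le_mxnorm (mxconj (col k A)) 0 s; rewrite mxconjE mxE.
  (* The conditions on [u] bound every term of row [s] by [alpha]; the term of index [k] is [alpha]
     itself. *)
  have xs : (A *m u) s 0 <= alpha.
    rewrite mxE; apply: mp_sum_le => j _.
    have {}uj : u j 0 <= alpha * maxplus_inv (A s j).
      by have [->|/uj//] := eqVneq j k; rewrite uk NE.
    move: (Ar s j) (ur j 0) alpha0 uj; rewrite mp_gt0.
    case: (A s j) (u j 0) alpha {uk} => [a|] [c|] [d|] // _ _ _.
    by rewrite /Order.le /= => ?; lra.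
  apply/eqP; rewrite eq_le spread_mulmx_le //=.
  apply: (@le_trans _ _ (spread (col k A))).
    by rewrite mxnorm_mul_conj; apply: mp_sum_le.
  (* With [i] the place of the largest entry of column [k], [x_i >= A i k * u k] and [x_s <= alpha]
     give [x_i / x_s >= A i k / A s k], the spread of that column. *)
  have [i [_ [Ni _]]] := spread_eq (col k A) m0.
  apply: le_trans (le_spread _ i s); rewrite /spread Ni NE mxE.
  have := le_mulmx_col A u i k; rewrite uk NE.
  move: (Ar i k) (Ar s k) (Aur i 0) (Aur s 0) alpha0 xs; rewrite mp_gt0.
  case: (A i k) (A s k) ((A *m u) i 0) ((A *m u) s 0) alpha {uj uk}
    => [a|] [b|] [c|] [d|] [e|] // _ _ _ _ _.
  by rewrite /Order.le /= => ? ?; lra.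
Qed.

End Norm.

(** * Walks, powers of a matrix and its asterate *)

Lemma not_uniq_cycle (T : eqType) (x : T) (p : seq T) : ~~ uniq (x :: p) ->
  exists p1 p2 p3 : seq T, [/\ p = p1 ++ p2 ++ p3, (0 < size p2)%N
    & last (last x p1) p2 = last x p1].
Proof.
elim: p x => [|y p IHp] x //; rewrite [uniq _]/= negb_and negbK.
case/orP=> [/splitPr[q r]|/IHp[p1 [p2 [p3 [-> p2_gt0 cyc]]]]].
  (* The start recurs: the cycle runs up to that recurrence. Otherwise the repetition lies in the
     tail. *)
  by exists [::], (rcons q x), r; rewrite size_rcons last_rcons cat_rcons.
by exists (y :: p1), p2, p3.
Qed.

Lemma uniq_size_ord n (i : 'I_n) (p : seq 'I_n) : uniq (i :: p) -> (size p < n)%N.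
Proof.
by move/card_uniqP => /= <-; rewrite -[n in (_ <= n)%N]card_ord max_card.
Qed.

Section Walks.
Variables (R : realType) (n : nat) (C : 'M[maxplus R]_n).
Implicit Types (i j : 'I_n) (p q : seq 'I_n).

(** The start [i] is not listed in [p], so [size p] counts the arcs. *)
Fixpoint walk_weight i p : maxplus R :=
  if p is j :: p' then C i j * walk_weight j p' else 1.

Lemma walk_weight_cat i p q :
  walk_weight i (p ++ q) = walk_weight i p * walk_weight (last i p) q.
Proof. by elim: p i => [|j p IHp] i /=; rewrite ?mul1r // IHp mulrA. Qed.

Lemma mxexprS k i j : (C ^+ k.+1) i j = \sum_l C i l * (C ^+ k) l j.
Proof. by rewrite exprS mxE. Qed.

Lemma walk_weight_le i p : walk_weight i p <= (C ^+ size p) i (last i p).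
Proof.
elim: p i => [|j p IHp] i /=; first by rewrite expr0 mxE eqxx.
rewrite mxexprS; apply: le_trans (mp_le_mul (lexx _) (IHp j)) _.
exact/(mp_le_sum (fun l => C i l * (C ^+ size p) l (last j p)))/mem_index_enum.
Qed.

(** Each sum defining a power is attained at one intermediate vertex. A zero entry is excluded
    because no walk need exist, as for [k = 0] and [i != j]. *)
Lemma mxexpr_walk k i j : (C ^+ k) i j != 0 ->
  exists p, [/\ size p = k, last i p = j & (C ^+ k) i j = walk_weight i p].
Proof.
elim: k i => [|k IHk] i.
  rewrite expr0 mxE; have [<- _|_] := eqVneq i j; first by exists [::].
  by rewrite eqxx.
rewrite mxexprS.
have [|l ->] := mp_sum_eq (fun l => C i l * (C ^+ k) l j).
  by apply/card_gt0P; exists i.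
have [->|/IHk[p [sp lp ->]] _] := eqVneq ((C ^+ k) l j) 0.
  by rewrite mulr0 eqxx.
by exists (l :: p); rewrite /= sp.
Qed.

Lemma mxexpr_le_asterate k i j : (k < n)%N -> (C ^+ k) i j <= asterate C i j.
Proof.
move=> kn; rewrite /asterate summxE.
exact/(mp_le_sum (fun k : 'I_n => (C ^+ k) i j)
  (i := Ordinal kn))/mem_index_enum.
Qed.

(** The weight is at most a diagonal entry of [C ^+ size p], whose trace is a term of [Tr C]. *)
Lemma cycle_weight_le1 i p : Tr C <= 1 -> (0 < size p <= n)%N -> last i p = i ->
  walk_weight i p <= 1.
Proof.
move=> TrC pn cyc; apply: le_trans TrC; apply: le_trans (walk_weight_le i p) _.
rewrite cyc; apply: (@le_trans _ _ (\tr (C ^+ size p))).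
  exact/(mp_le_sum (fun i => (C ^+ size p) i i))/mem_index_enum.
by apply/(mp_le_sum (fun k => \tr (C ^+ k))); rewrite mem_index_iota ltnS.
Qed.

(** A walk with [n] arcs lists [n + 1] vertices, so it contains a cycle; deleting it does not lower
    the weight and leaves fewer than [n] arcs. *)
Lemma mxexprn_le_asterate i j : Tr C <= 1 -> (C ^+ n) i j <= asterate C i j.
Proof.
move=> TrC; have [->|/mxexpr_walk[p [sp lp ->]]] := eqVneq ((C ^+ n) i j) 0.
  exact: mp_ge0.
have /not_uniq_cycle[p1 [p2 [p3 [pE p2_gt0 cyc]]]] : ~~ uniq (i :: p).
  by apply/negP => /uniq_size_ord; rewrite sp ltnn.
have spE : (size p1 + size p2 + size p3 = n)%N by move: sp; rewrite pE !size_cat addnA.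
have lpE : last i (p1 ++ p3) = j by rewrite -lp pE !last_cat cyc.
apply: (@le_trans _ _ (walk_weight i (p1 ++ p3))).
  rewrite pE !walk_weight_cat cyc mp_le_mul // -[leRHS]mul1r mp_le_mul //.
  by apply: cycle_weight_le1 => //; rewrite p2_gt0 -[leqRHS]spE addnAC leq_addl.
rewrite -lpE; apply: le_trans (walk_weight_le _ _) (mxexpr_le_asterate _ _ _).
by rewrite size_cat -[ltnRHS]spE addnAC -[ltnLHS]addn0 ltn_add2l.
Qed.

(** Multiplying by [C] shifts the exponents to [1, ..., n], and only [n] falls outside the
    asterate. *)
Lemma mulmx_asterate_le i j : Tr C <= 1 ->
  (C *m asterate C) i j <= asterate C i j.
Proof.
move=> TrC; rewrite /asterate mulmx_sumr summxE; apply: mp_sum_le => k _.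
rewrite -[C *m _]/(C * C ^+ k) -exprS; have := ltn_ord k.
by rewrite leq_eqVlt => /predU1P[->|];
  [apply: mxexprn_le_asterate | apply: mxexpr_le_asterate].
Qed.

Lemma walk_weight_neq0 i p :
  path [rel i j | C i j != 0] i p -> walk_weight i p != 0.
Proof.
elim: p i => [|j p IHp] i //= /andP[Cij /IHp]; exact: mp_mul_neq0.
Qed.

Lemma irreducible_connect i j :
  irreducible C -> connect [rel i j | C i j != 0] i j.
Proof.
move=> C_irr; apply/negPn/negP => nij; apply: C_irr.
(* No arc leaves the set [S] of vertices reachable from [i]. Listing [S] before its complement thus
   makes the upper right block zero, with [p = #|S|]. *)
set S := [set x | connect [rel i j | C i j != 0] i x].
pose l := enum S ++ enum (~: S).
have sl : size l = n by rewrite size_cat -!cardE cardsC card_ord.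
have l_uniq : uniq l.
  rewrite cat_uniq !enum_uniq andbT /=; apply/hasPn => x.
  by rewrite !mem_enum inE.
have l_inj : injective (fun k : 'I_n => nth i l k).
  move=> a b /eqP; rewrite nth_uniq ?sl ?ltn_ord // => /eqP; exact: val_inj.
have iS : i \in S by rewrite inE connect0.
have jS : j \notin S by rewrite inE.
have Cn0 x y : x \in S -> y \notin S -> C x y = 0.
  rewrite !inE => ix; apply: contraNeq => Cxy.
  exact: connect_trans ix (connect1 Cxy).
exists (perm l_inj), #|S|; split.
  apply/andP; split; first by apply/card_gt0P; exists i.
  rewrite -[ltnRHS]card_ord -cardsT; apply: proper_card.
  by rewrite properE subsetT; apply/subsetPn; exists j; rewrite ?inE.
left => a b /andP[aS bS]; rewrite !mxE !permE !nth_cat -cardE aS ltnNge bS /=.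
apply: Cn0; first by rewrite -mem_enum mem_nth // -cardE.
suff : nth i (enum (~: S)) (b - #|S|) \in ~: S by rewrite inE.
rewrite -mem_enum mem_nth // -cardE -(ltn_add2r #|S|) subnK //.
by rewrite addnC cardsC card_ord.
Qed.

(** A path without repeated vertices has fewer than [n] arcs, so its nonzero weight bounds an entry
    of the asterate from below. *)
Lemma asterate_regular : irreducible C -> mxregular (asterate C).
Proof.
move=> C_irr i j; have /connectP[p0 p0P ->] := irreducible_connect i j C_irr.
case/shortenP: p0P => p pP p_uniq _; apply/negP => /eqP Cs0.
have := le_trans (walk_weight_le i p)
  (mxexpr_le_asterate i (last i p) (uniq_size_ord p_uniq)).
by rewrite Cs0 => w0; have := walk_weight_neq0 pP; rewrite eq_le w0 mp_ge0.
Qed.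

End Walks.

(** * Feasible vectors as images of the asterate *)

Section Feasible.
Variables (R : realType) (n : nat) (C : 'M[maxplus R]_n).

Lemma mxexpr_mul_feasible k (x : 'cV_n) :
  mxle (C *m x) x -> mxle (C ^+ k *m x) x.
Proof.
move=> Cx; elim: k => [|k IHk] i j; first by rewrite expr0 mul1mx.
rewrite exprS -[C * _]/(C *m _) -mulmxA.
exact: le_trans (mulmx_le C IHk i j) (Cx i j).
Qed.

(** All [C ^+ k *m x] lie below [x], and the term [k = 0] is [x] itself. *)
Lemma asterate_mul_feasible (x : 'cV_n) :
  mxle (C *m x) x -> asterate C *m x = x.
Proof.
move=> Cx; apply/matrixP => i j; apply/eqP.
rewrite eq_le /asterate mulmx_suml summxE; apply/andP; split.
  by apply: mp_sum_le => k _; apply: mxexpr_mul_feasible.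
have n0 : (0 < n)%N := leq_ltn_trans (leq0n i) (ltn_ord i).
have := mp_le_sum (fun k : 'I_n => (C ^+ k *m x) i j)
  (mem_index_enum (Ordinal n0)).
by rewrite /= expr0 mul1mx.
Qed.

Lemma mulmx_asterate_feasible m (D : 'M_(n, m)) : Tr C <= 1 ->
  mxle (C *m (asterate C *m D)) (asterate C *m D).
Proof.
move=> TrC i j; rewrite mulmxA !mxE; apply: mp_sum_le => k _.
apply: le_trans (mp_le_mul (mulmx_asterate_le i k TrC) (lexx _)) _.
exact/(mp_le_sum (fun k => asterate C i k * D k j))/mem_index_enum.
Qed.

End Feasible.

Theorem lemma6 (R : realType) (n : nat) (C : 'M[maxplus R]_n)
    (n_gt0 : (0 < n)%N) (C_irr : irreducible C) (TrC : Tr C <= 1) :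
  let Cs := asterate C in
  let Delta := mxnorm (Cs *m mxconj Cs) in
  let feasible (x : 'cV[maxplus R]_n) := mxle (C *m x) x in
  let objective (x : 'cV[maxplus R]_n) := mxnorm x * mxnorm (mxconj x) in
  [/\ exists x : 'cV[maxplus R]_n,
        [/\ mxregular x, feasible x & objective x = Delta],
      forall x : 'cV[maxplus R]_n,
        mxregular x -> feasible x -> objective x <= Delta
    & forall x : 'cV[maxplus R]_n, mxregular x ->
        (feasible x /\ objective x = Delta) <->
        exists u : 'cV[maxplus R]_n,
          [/\ mxregular u, x = Cs *m u
            & exists (alpha : maxplus R) (k s : 'I_n),
                [/\ 0 < alpha :> maxplus R,
                    forall i : 'I_n,
                      mxnorm (col i Cs) * mxnorm (mxconj (col i Cs)) <=
                      mxnorm (col k Cs) * mxnorm (mxconj (col k Cs)),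
                    forall i : 'I_n,
                      maxplus_inv (Cs i k) <= maxplus_inv (Cs s k),
                    u k 0 = alpha * mxnorm (mxconj (col k Cs))
                  & forall j : 'I_n, j != k ->
                      u j 0 <= alpha * maxplus_inv (Cs s j)]]].
Proof.
move=> Cs Delta feasible objective.
have Csr : mxregular Cs := asterate_regular C_irr.
split.
- have [|k kE] := mp_sum_eq (fun k => spread (col k Cs)).
    by rewrite card_ord.
  (* A column of largest spread attains the maximum; it is feasible as the product of [Cs] and a
     unit vector. *)
  exists (col k Cs); split.
  + by move=> i j; rewrite mxE.
  + by rewrite /feasible colE; apply: mulmx_asterate_feasible.
  + by rewrite /Delta mxnorm_mul_conj kE.
- move=> x xr /asterate_mul_feasible xE.
  by rewrite -xE; apply: spread_mulmx_le.
- move=> x xr; split.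
  + move=> [/asterate_mul_feasible xE xmax].
    (* A feasible [x] is fixed by [Cs], so it serves as its own [u]. *)
    exists x; split => //; apply/spread_mulmx_eq => //.
    by rewrite /Cs xE.
  + move=> [u [ur -> umax]]; split; first exact: mulmx_asterate_feasible.
    exact/spread_mulmx_eq.
Qed.
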